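(* Let $X$ be a nonempty topological space and let $S$ be a semigroup (under composition, with unity the identity map of $X$) of continuous functions $X\to X$. Suppose that there exists $\phi\in Z(S)$ which is aperiodic, and that $P^{+}(X,S)$ is nonempty. Then, for every $\ell\ge 2$, $$P^{+}(X,S,\mathbb{C}^{\ell})\subsetneq P^{+}_{proj}(X,S,\mathbb{C}^{\ell}).$$
   Context: A kernel $K:X\times X\to M_\ell(\mathbb{C})$ is positive definite if for all finitely many distinct points $x_1,\dots,x_n\in X$ and vectors $v_1,\dots,v_n\in\mathbb{C}^\ell$ one has $\sum_{\mu,\nu=1}^n\langle K(x_\mu,x_\nu)v_\mu,v_\nu\rangle\ge 0$; it is strictly positive definite if moreover the inequality is strict whenever at least one $v_\mu$ is nonzero. For $v\in\mathbb{C}^\ell\setminus\{0\}$, the scalar valued projection of $K$ is the scalar kernel $K_v(x,y)=\langle K(x,y)v,v\rangle$. Scalar kernels are the case $\ell=1$. A kernel $K$ is unitarily invariant by $S$ if $K(\phi(x),\phi(y))=K(x,y)$ for all $x,y\in X$ and $\phi\in S$. $P^{+}(X,S,\mathbb{C}^\ell)$ is the set of continuous kernels $K:X\times X\to M_\ell(\mathbb{C})$ that are unitarily invariant by $S$ and strictly positive definite; $P^{+}(X,S):=P^{+}(X,S,\mathbb{C}^1)$. $P^{+}_{proj}(X,S,\mathbb{C}^\ell)$ is the set of continuous kernels $K:X\times X\to M_\ell(\mathbb{C})$ that are unitarily invariant by $S$ and such that $K_v$ is strictly positive definite for every $v\in\mathbb{C}^\ell\setminus\{0\}$. $Z(S)=\{\phi\in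 S:\phi\psi=\psi\phi\text{ for all }\psi\in S\}$ is the center of $S$. A function $\phi:X\to X$ is aperiodic if $\phi^m(x)\ne x$ for all $x\in X$ and all integers $m\ge 1$, where $\phi^m$ is the $m$-fold composition. *)

(* Defs.v *)
From mathcomp Require Import all_boot all_order all_algebra.
From mathcomp Require Import complex.
From mathcomp Require Import all_classical all_reals all_analysis.

Set Implicit Arguments.
Unset Strict Implicit.
Unset Printing Implicit Defensive.

Import Order.TTheory GRing.Theory Num.Theory.
Import numFieldNormedType.Exports.

Local Open Scope classical_set_scope.
Local Open Scope ring_scope.

(* MathComp-Analysis derives a topology from the norm of an element of
   [numFieldType], but [R[i]] itself is not recognized as a topological space;
   hence this packed version, which also gives ['M[Cplx R]_l] its (entrywise)
   topology. In [Cplx R], [0 <= z] means that [z] is real and nonnegative. *)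
Definition Cplx (R : realType) : numClosedFieldType := R[i].

Section Kernels.
Variables (R : realType) (X : topologicalType).
Local Notation C := (Cplx R).

Definition inner (l : nat) (u v : 'cV[C]_l) : C :=
  \sum_(i < l) u i 0 * (v i 0)^*.

Definition kernel_sum (l : nat) (K : X -> X -> 'M[C]_l) (n : nat)
    (x : 'I_n -> X) (v : 'I_n -> 'cV[C]_l) : C :=
  \sum_(mu < n) \sum_(nu < n) inner (K (x mu) (x nu) *m v mu) (v nu).

Definition positive_definite (l : nat) (K : X -> X -> 'M[C]_l) : Prop :=
  forall (n : nat) (x : 'I_n -> X) (v : 'I_n -> 'cV[C]_l),
    injective x -> 0 <= kernel_sum K x v.

Definition strictly_positive_definite (l : nat) (K : X -> X -> 'M[C]_l) : Prop :=
  positive_definite K /\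
  forall (n : nat) (x : 'I_n -> X) (v : 'I_n -> 'cV[C]_l),
    injective x -> (exists mu, v mu != 0) -> 0 < kernel_sum K x v.

(* A scalar kernel is a kernel with values in the 1 x 1 matrices. *)
Definition scalar_projection (l : nat) (K : X -> X -> 'M[C]_l) (v : 'cV[C]_l)
    : X -> X -> 'M[C]_1 :=
  fun x y => (inner (K x y *m v) v)%:M.

Definition unitarily_invariant (S : set (X -> X)) (l : nat)
    (K : X -> X -> 'M[C]_l) : Prop :=
  forall (x y : X) (phi : X -> X), S phi -> K (phi x) (phi y) = K x y.

Definition continuous_kernel (l : nat) (K : X -> X -> 'M[C]_l) : Prop :=
  continuous (fun p : X * X => K p.1 p.2).

Definition Pplus (S : set (X -> X)) (l : nat) : set (X -> X -> 'M[C]_l) :=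
  [set K | [/\ continuous_kernel K, unitarily_invariant S K
             & strictly_positive_definite K]].

Definition Pplus_proj (S : set (X -> X)) (l : nat) : set (X -> X -> 'M[C]_l) :=
  [set K | [/\ continuous_kernel K, unitarily_invariant S K
             & forall v : 'cV[C]_l, v != 0 ->
                 strictly_positive_definite (scalar_projection K v)]].

End Kernels.

Arguments Pplus R {X} S l _.
Arguments Pplus_proj R {X} S l _.

Definition continuous_semigroup (X : topologicalType) (S : set (X -> X)) : Prop :=
  [/\ forall phi, S phi -> continuous phi,
      S idfun
    & forall phi psi, S phi -> S psi -> S (phi \o psi)].

Definition semigroup_center (T : Type) (S : set (T -> T)) : set (T -> T) :=
  [set phi | S phi /\ forall psi, S psi -> phi \o psi = psi \o phi].

Definition aperiodic (T : Type) (phi : T -> T) : Prop :=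
  forall (x : T) (m : nat), (1 <= m)%N -> iter m phi x <> x.

(* Main.v *)
Require Import Defs.
From mathcomp Require Import all_boot all_order all_algebra.
From mathcomp Require Import complex.
From mathcomp Require Import all_classical all_reals all_analysis.
From mathcomp Require Import ring.

Import Order.TTheory GRing.Theory Num.Theory.
Import numFieldNormedType.Exports.

Local Open Scope classical_set_scope.
Local Open Scope ring_scope.

(** Let [k] be a scalar kernel in [Pplus R S 1] and [phi] a central aperiodic
    map. The invariance of [k] makes [phi] act as an isometry [U] on the
    features [d_x], where [k(x,y) = <d_x, d_y>]. The matrix kernel
    [K_ij(x,y) = k(phi^j x, phi^i y)] is the Gram kernel of the feature map
    [x |-> (d_x, U d_x, ..., U^(l-1) d_x)]. It is not strictly positive definite
    since [U d_x] is a coordinate of the features of both [x] and [phi x].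
    Its projection along [v] has the features [p(U) d_x], [p = sum_i v_i t^i].
    If [g = sum_mu c_mu d_(x_mu)] is nonzero, choose [x_mu] in its support such
    that no [phi^m x_mu], [m >= 1], is in the support: this is possible as [phi]
    is aperiodic. Then [phi^(deg p) x_mu] occurs exactly once in [p(U) g], so
    that [p(U) g] is nonzero. *)

(** * Finite families of points: repetitions and orbits *)

Section FinitePoints.

(** Positive definiteness speaks of distinct points only, whereas the points [iter i phi (x mu)] may
    coincide; [x] enumerates the distinct values of [p]. *)
Lemma factor_through_injection {I : finType} {T : eqType} (p : I -> T) :
  exists (n : nat) (x : 'I_n -> T) (q : I -> 'I_n),
    injective x /\ p =1 x \o q.
Proof.
pose s := undup (codom p).
have ps i : p i \in s by rewrite mem_undup codom_f.
have lt_index i : (index (p i) s < size s)%N by rewrite index_mem.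
exists (size s), (tnth (in_tuple s)), (fun i => Ordinal (lt_index i)); split.
  by apply/tuple_uniqP; rewrite /= undup_uniq.
by move=> i /=; rewrite (tnth_nth (p i)) /= nth_index.
Qed.

Lemma aperiodic_last_point {I : finType} {T : Type} {phi : T -> T} (x : I -> T)
    (P : pred I) (i0 : I) :
  aperiodic phi -> P i0 ->
  exists2 i, P i &
    forall j m, P j -> (1 <= m)%N -> iter m phi (x i) <> x j.
Proof.
move=> aper Pi0.
(* [B i] collects the indices in [P] whose point reaches [x i] after at least one step. If [x i]
   reaches [x j], then [B j] contains [B i] and also [i], which aperiodicity keeps out of [B i]. So
   an [i] with [B i] of maximal size works. *)
pose B i :=
  [set j | P j && `[< exists2 m, (0 < m)%N & iter m phi (x j) = x i >]]%SET.
case: (@arg_maxnP I i0 P (fun i => #|B i|) Pi0) => i Pi maxi.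
exists i => // j m Pj m_gt0 xij.
suff /proper_card : B i \proper B j by apply/negP; rewrite -leqNgt; exact: maxi.
apply/fintype.properP; split.
  apply/fintype.subsetP => k; rewrite !inE => /andP[-> /asboolP[m' m'_gt0 xki]] /=.
  apply/asboolP; exists (m + m')%N; first by rewrite addn_gt0 m_gt0.
  by rewrite iterD xki.
exists i; rewrite !inE Pi /=; first by apply/asboolP; exists m.
by apply/asboolP => -[m' m'_gt0]; exact: aper.
Qed.

End FinitePoints.

Section Kernels.
Variables (R : realType) (X : topologicalType).
Local Notation C := (Cplx R).

(** * Sums over families with repeated points *)

Lemma kernel_sumE (l : nat) (K : X -> X -> 'M[C]_l) (n : nat)
    (x : 'I_n -> X) (v : 'I_n -> 'cV[C]_l) :
  kernel_sum K x v = \sum_(a : 'I_n * 'I_l) \sum_(b : 'I_n * 'I_l)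
    K (x a.1) (x b.1) b.2 a.2 * v a.1 a.2 0 * (v b.1 b.2 0)^*.
Proof.
rewrite /kernel_sum -(pair_bigA _ (fun mu i => \sum_(b : 'I_n * 'I_l)
  K (x mu) (x b.1) b.2 i * v mu i 0 * (v b.1 b.2 0)^*)) /=.
apply: eq_bigr => mu _.
rewrite [RHS]exchange_big -(pair_bigA _ (fun nu j => \sum_(i < l)
  K (x mu) (x nu) j i * v mu i 0 * (v nu j 0)^*)) /=.
apply: eq_bigr => nu _; rewrite /inner; apply: eq_bigr => j _.
by rewrite mxE big_distrl.
Qed.

Lemma kernel_sum1E (K : X -> X -> 'M[C]_1) (n : nat)
    (x : 'I_n -> X) (v : 'I_n -> 'cV[C]_1) :
  kernel_sum K x v = \sum_(mu < n) \sum_(nu < n)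
    K (x mu) (x nu) 0 0 * v mu 0 0 * (v nu 0 0)^*.
Proof.
apply: eq_bigr => mu _; apply: eq_bigr => nu _.
by rewrite /inner big_ord1 mxE big_ord1.
Qed.

Lemma kernel_sum_projection (l : nat) (K : X -> X -> 'M[C]_l) (v : 'cV[C]_l)
    (n : nat) (x : 'I_n -> X) (c : 'I_n -> 'cV[C]_1) :
  kernel_sum (scalar_projection K v) x c =
  kernel_sum K x (fun mu => c mu 0 0 *: v).
Proof.
rewrite kernel_sum1E; apply: eq_bigr => mu _; apply: eq_bigr => nu _.
rewrite /scalar_projection mxE eqxx mulr1n /inner -scalemxAr.
rewrite !mulr_suml; apply: eq_bigr => i _ /=.
by rewrite !mxE rmorphM /=; ring.
Qed.

(** The form is sesquilinear in the coefficients, so those at coinciding points add up. *)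
Lemma kernel_sum_regroup (K : X -> X -> 'M[C]_1) (I : finType) (p : I -> X)
    (a : I -> C) (n : nat) (x : 'I_n -> X) (q : I -> 'I_n) :
  p =1 x \o q ->
  \sum_i \sum_j K (p i) (p j) 0 0 * a i * (a j)^* =
  kernel_sum K x (fun mu => (\sum_(i | q i == mu) a i)%:M).
Proof.
move=> pE; rewrite kernel_sum1E (partition_big q predT) //=.
apply: eq_bigr => mu _.
under eq_bigr => i _ do rewrite (partition_big q predT) //=.
rewrite exchange_big /=; apply: eq_bigr => nu _.
rewrite !mxE eqxx !mulr1n mulr_sumr mulr_suml.
apply: eq_bigr => i /eqP qi; rewrite rmorph_sum mulr_sumr.
by apply: eq_bigr => j /eqP qj; rewrite !pE /= qi qj.
Qed.

Lemma positive_definite_sum_ge0 (K : X -> X -> 'M[C]_1) (I : finType)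
    (p : I -> X) (a : I -> C) :
  positive_definite K ->
  0 <= \sum_i \sum_j K (p i) (p j) 0 0 * a i * (a j)^*.
Proof.
move=> K_pd; have [n [x [q [x_inj pE]]]] := factor_through_injection p.
by rewrite (kernel_sum_regroup _ _ _ _ _ _ _ pE); exact: K_pd.
Qed.

Lemma strictly_positive_definite_sum_gt0 (K : X -> X -> 'M[C]_1) (I : finType)
    (p : I -> X) (a : I -> C) (i0 : I) :
  strictly_positive_definite K -> \sum_(i | p i == p i0) a i != 0 ->
  0 < \sum_i \sum_j K (p i) (p j) 0 0 * a i * (a j)^*.
Proof.
move=> [_ K_spd] a_neq0.
have [n [x [q [x_inj pE]]]] := factor_through_injection p.
rewrite (kernel_sum_regroup _ _ _ _ _ _ _ pE); apply: K_spd => //.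
(* As [x] is injective, the fibre of [q] over [q i0] is that of [p] over [p i0]. *)
exists (q i0); apply: contraNneq a_neq0 => /matrixP/(_ 0 0).
rewrite !mxE eqxx mulr1n => a0; apply/eqP; rewrite -[RHS]a0.
by apply: eq_bigl => i; rewrite !pE /= (inj_eq x_inj).
Qed.

(** If [phi] identified distinct [x] and [y], invariance would make [K] constant on pairs from these
    two points, and the coefficients 1 and -1 would give the sum 0. *)
Lemma invariant_spd_injective (K : X -> X -> 'M[C]_1) (S : set (X -> X))
    (phi : X -> X) :
  unitarily_invariant S K -> strictly_positive_definite K -> S phi ->
  injective phi.
Proof.
move=> K_inv K_spd S_phi x y phi_xy; apply/eqP/negP => /negP xy.
pose p (b : bool) := if b then x else y.
pose a (b : bool) : C := if b then 1 else -1.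
have /= := strictly_positive_definite_sum_gt0 K _ p a true K_spd.
have Kp b b' : K (p b) (p b') = K (phi x) (phi x).
  by rewrite -(K_inv _ _ _ S_phi); case: b; case: b'; rewrite /= -?phi_xy.
rewrite !big_bool !Kp /= rmorphN /= conjC1 !mulr1 !mulrN1 addrN opprK addNr addr0 ltxx.
rewrite (big_pred1 true) ?oner_eq0; first by move/(_ isT).
by case; rewrite /= ?eqxx // eq_sym (negbTE xy).
Qed.

Lemma Pplus_sub_Pplus_proj (S : set (X -> X)) (l : nat) :
  Pplus R S l `<=` Pplus_proj R S l.
Proof.
move=> K [K_cont K_inv [K_pd K_spd]]; split=> // v v_neq0; split.
  by move=> n x c x_inj; rewrite kernel_sum_projection; exact: K_pd.
move=> n x c x_inj [mu c_neq0]; rewrite kernel_sum_projection.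
apply: K_spd => //; exists mu; rewrite scaler_eq0 negb_or v_neq0 andbT.
apply: contraNneq c_neq0 => c0; apply/eqP/matrixP => i j.
by rewrite !ord1 c0 mxE.
Qed.

(** * The matrix kernel along orbits *)

Lemma continuous_matrix (T U : topologicalType) (m n : nat)
    (f : T -> 'M[U]_(m, n)) :
  (forall i j, continuous (fun t => f t i j)) -> continuous f.
Proof.
move=> f_cont t A [P ftP sPA]; rewrite /nbhs /=.
apply: (@filterS _ (nbhs t) _ [set s | forall i j, P i j (f s i j)]).
  by move=> s Ps; apply: sPA.
by apply: filter_forall => i; apply: filter_forall => j; exact/f_cont/ftP.
Qed.

(** The column index [j] goes with [x], since the vector attached to the first argument is the one
    that the matrix acts on. *)
Definition orbit_kernel (phi : X -> X) (K : X -> X -> 'M[C]_1) (l : nat)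
    : X -> X -> 'M[C]_l :=
  fun x y => \matrix_(i, j) K (iter j phi x) (iter i phi y) 0 0.

Section OrbitKernel.
Variables (phi : X -> X) (K : X -> X -> 'M[C]_1) (l : nat).

Lemma kernel_sum_orbit_kernel (n : nat) (x : 'I_n -> X) (v : 'I_n -> 'cV[C]_l) :
  let p (a : 'I_n * 'I_l) := iter a.2 phi (x a.1) in
  kernel_sum (orbit_kernel phi K l) x v =
  \sum_a \sum_b K (p a) (p b) 0 0 * v a.1 a.2 0 * (v b.1 b.2 0)^*.
Proof.
by rewrite /= kernel_sumE; do 2!apply: eq_bigr => ? _; rewrite mxE.
Qed.

Lemma continuous_orbit_kernel :
  continuous phi -> continuous_kernel K ->
  continuous_kernel (orbit_kernel phi K l).
Proof.
move=> phi_cont K_cont.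
have iter_cont n : continuous (iter n phi).
  elim: n => [|n IHn] x; first exact: cvg_id.
  by apply: continuous_comp; [exact: IHn | exact: phi_cont].
apply: continuous_matrix => i j p.
rewrite (_ : (fun _ => _) = (fun M : 'M[C]_1 => M 0 0) \o
  ((fun q : X * X => K q.1 q.2) \o
   (fun q : X * X => (iter j phi q.1, iter i phi q.2)))); last first.
  by apply/funext => q; rewrite mxE.
apply: continuous_comp; last exact: coord_continuous.
apply: continuous_comp; last exact: K_cont.
apply: cvg_pair => /=.
  by apply: continuous_comp; [exact: cvg_fst | exact: iter_cont].
by apply: continuous_comp; [exact: cvg_snd | exact: iter_cont].
Qed.

Lemma unitarily_invariant_orbit_kernel (S : set (X -> X)) :
  semigroup_center S phi -> unitarily_invariant S K ->
  unitarily_invariant S (orbit_kernel phi K l).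
Proof.
move=> [_ phiC] K_inv x y psi S_psi; apply/matrixP => i j; rewrite !mxE.
have iterC n z : iter n phi (psi z) = psi (iter n phi z).
  by elim: n => //= n ->; exact: (congr1 (@^~ _) (phiC _ S_psi)).
by rewrite !iterC K_inv.
Qed.

Lemma projection_orbit_kernel_spd (v : 'cV[C]_l) :
  injective phi -> aperiodic phi -> strictly_positive_definite K -> v != 0 ->
  strictly_positive_definite (scalar_projection (orbit_kernel phi K l) v).
Proof.
move=> phi_inj aper K_spd v_neq0; split=> n x c x_inj.
  rewrite kernel_sum_projection kernel_sum_orbit_kernel.
  by apply: (positive_definite_sum_ge0 K _ _ (fun a => _)); case: K_spd.
move=> [mu0 c_neq0]; rewrite kernel_sum_projection kernel_sum_orbit_kernel.
have c00 mu : (c mu 0 0 != 0) = (c mu != 0).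
  congr (~~ _); apply/eqP/eqP => [c0|->]; last by rewrite mxE.
  by apply/matrixP => i j; rewrite !ord1 c0 mxE.
have [mu cmu mu_last] :=
  aperiodic_last_point x (fun mu => c mu 0 0 != 0) mu0 aper
    (etrans (c00 _) c_neq0).
have [i0 vi0] : exists i0, v i0 0 != 0.
  apply/existsP; apply: contraNT v_neq0; rewrite negb_exists => /forallP v0.
  apply/eqP/matrixP => i j; rewrite ord1 mxE.
  by apply/eqP; move: (v0 i); rewrite negbK.
(* [d] is the degree of the polynomial with coefficients [v]. *)
case: (@arg_maxnP _ i0 (fun i => v i 0 != 0) (@nat_of_ord l) vi0) => d vd dmax.
apply: (strictly_positive_definite_sum_gt0 K _ _ (fun a => (c a.1 0 0 *: v) a.2 0)
  (mu, d) K_spd).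
rewrite (bigD1 (mu, d)) //= big1 ?addr0; first by rewrite mxE mulf_neq0.
move=> [nu i] /= /andP[/eqP eq_pts neq]; rewrite mxE.
apply/eqP/negPn/negP; rewrite mulf_eq0 negb_or => /andP[cnu vi].
have le_id : (i <= d)%N := dmax _ vi.
have iter_inj m : injective (iter m phi).
  by elim: m => //= m IHm y z /phi_inj/IHm.
(* Cancelling [phi^i] puts [x nu] on the orbit of [x mu]: the choice of [mu] excludes [i < d], and
   [i = d] forces [nu = mu]. *)
have {eq_pts} nu_mu : iter (d - i) phi (x mu) = x nu.
  by apply: (iter_inj i); rewrite -iterD subnKC.
have [di|di] := posnP (d - i)%N; last exact: mu_last nu_mu.
move/negP: neq; apply; rewrite di /= in nu_mu.
apply/eqP; congr pair; first exact/x_inj.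
by apply/val_inj/eqP; rewrite eqn_leq le_id -subn_eq0 di.
Qed.

Lemma orbit_kernel_not_spd :
  [set: X] !=set0 -> aperiodic phi -> (2 <= l)%N ->
  ~ strictly_positive_definite (orbit_kernel phi K l).
Proof.
move=> [x0 _] aper l_ge2 [_ spd].
pose i0 : 'I_l := Ordinal (ltnW l_ge2); pose i1 : 'I_l := Ordinal l_ge2.
pose x (mu : 'I_2) := iter mu phi x0.
(* Both vectors select the point [phi x0], with opposite signs, so the four terms are
   [K (phi x0) (phi x0) 0 0] up to sign and cancel. *)
pose v (mu : 'I_2) : 'cV[C]_l :=
  if mu == 0 then delta_mx i1 0 else - delta_mx i0 0.
have x_inj : injective x.
  have x01 : x0 <> phi x0 by move/esym; exact: (aper x0 1%N).
  by move=> [[|[|m]] ?] [[|[|m']] ?] // e; try exact/val_inj; case: x01.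
have inner_delta (M : 'M[C]_l) i j :
    inner (M *m delta_mx i 0) (delta_mx j 0) = M j i.
  rewrite /inner (bigD1 j) //= big1 => [|k kj]; last first.
    by rewrite [delta_mx j 0 k 0]mxE (negbTE kj) rmorph0 mulr0.
  rewrite addr0 [delta_mx j 0 j 0]mxE !eqxx rmorph1 mulr1 -colE.
  by rewrite mxE.
have innerN (u w : 'cV[C]_l) : inner u (- w) = - inner u w.
  by rewrite /inner -sumrN; apply: eq_bigr => i _; rewrite mxE rmorphN mulrN.
have innerNl (u w : 'cV[C]_l) : inner (- u) w = - inner u w.
  by rewrite /inner -sumrN; apply: eq_bigr => i _; rewrite mxE mulNr.
have /spd : exists mu, v mu != 0.
  exists 0; rewrite /v eqxx; apply/eqP => /matrixP/(_ i1 0)/eqP.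
  by rewrite !mxE !eqxx oner_eq0.
move=> /(_ x x_inj).
rewrite /kernel_sum !big_ord_recl !big_ord0 /v /= !mulmxN !innerN !innerNl.
by rewrite !inner_delta !mxE /= !addr0 opprK addrN addNr addr0 ltxx.
Qed.

End OrbitKernel.

End Kernels.

Theorem theorem2p8 (R : realType) (X : topologicalType) (S : set (X -> X))
    (X_nonempty : [set: X] !=set0)
    (S_semigroup : continuous_semigroup S)
    (S_aperiodic : exists phi : X -> X, semigroup_center S phi /\ aperiodic phi)
    (Pplus_nonempty : Pplus R S 1 !=set0)
    (l : nat) (l_ge2 : (2 <= l)%N) :
  Pplus R S l `<` Pplus_proj R S l.
Proof.
split; first exact: Pplus_sub_Pplus_proj.
have [phi [phi_center aper]] := S_aperiodic.
have [K [K_cont K_inv K_spd]] := Pplus_nonempty.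
have [S_cont _ _] := S_semigroup; have [S_phi _] := phi_center.
move=> /(_ (orbit_kernel R X phi K l)) [].
  split.
  - exact: continuous_orbit_kernel (S_cont _ S_phi) K_cont.
  - exact: unitarily_invariant_orbit_kernel phi_center K_inv.
  - move=> v; apply: projection_orbit_kernel_spd => //.
    exact: invariant_spd_injective K_inv K_spd S_phi.
by move=> _ _; exact: orbit_kernel_not_spd.
Qed.
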